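(* Let $G$ be a connected graph (finite or infinite, not necessarily locally finite). Then $G$ has a non-elusive $\mathbb{Z}_4$-flow if and only if $G$ is semi-$3$-edge-colorable.
   Context: Graphs may have parallel edges. A cut of $G=(V,E)$ is the set $E(X,Y)$ of all edges between $X$ and $Y=V\setminus X$ for some $X\subseteq V$. A directed edge is a triple $(e,x,y)$ with $e=xy\in E$. For a finite abelian group $H$ (with the discrete topology), a non-elusive $H$-flow of $G$ is a map $f$ from the set of directed edges to $H\setminus\{0\}$ with $f(e,x,y)=-f(e,y,x)$ for every non-loop edge $e=xy$, such that for every finite cut $E(X,Y)$ the sum of $f(e,x,y)$ over all directed edges with $x\in X$, $y\in Y$ is $0$. For a positive integer $k$, a semi-$k$-edge-coloring of $G$ is a map $E\to\{1,\dots,k\}$ such that for every finite cut $C$ of $G$, if $c_i$ denotes the number of edges of $C$ with color $i$, then $c_1,\dots,c_k$ all have the same parity. $G$ is semi-$k$-edge-colorable if it has a semi-$k$-edge-coloring. *)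

(* Defs.v *)
From Stdlib Require Export Relation_Operators.
From HB Require Import structures.
From mathcomp Require Export all_boot all_order all_algebra.
From mathcomp Require Export finmap.
From mathcomp Require Export boolp classical_sets functions cardinality fsbigop.

Set Implicit Arguments.
Unset Strict Implicit.
Unset Printing Implicit Defensive.
Import GRing.Theory.
Local Open Scope classical_set_scope.
Local Open Scope ring_scope.

(* Undirected graphs of arbitrary cardinality, with loops and parallel edges.
   The axiom gives each edge an unordered pair of ends, equal for a loop.
   Requiring choice types is no restriction, since every type classically
   carries such a structure. *)
Record multigraph := Multigraph {
  vertex : choiceType;
  edge : choiceType;
  joins : edge -> vertex -> vertex -> Prop;
  joinsP : forall e, exists x y, forall u v,
    joins e u v <-> (u = x /\ v = y) \/ (u = y /\ v = x) }.

Definition adjacent (G : multigraph) (x y : vertex G) : Prop :=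
  exists e : edge G, joins e x y.

Definition connected_graph (G : multigraph) : Prop :=
  forall x y : vertex G, clos_refl_trans (vertex G) (@adjacent G) x y.

Definition cut (G : multigraph) (X : set (vertex G)) : set (edge G) :=
  [set e | exists x y, [/\ joins e x y, X x & (~` X) y]].

(* A non-loop edge gives two directed edges, a loop only one. *)
Definition directed_edges (G : multigraph) :
    set (edge G * vertex G * vertex G) :=
  [set d | joins d.1.1 d.1.2 d.2].

Definition dedge (G : multigraph) : choiceType := set_type (@directed_edges G).

Definition dedge_edge (G : multigraph) (d : dedge G) : edge G := (val d).1.1.
Definition source (G : multigraph) (d : dedge G) : vertex G := (val d).1.2.
Definition target (G : multigraph) (d : dedge G) : vertex G := (val d).2.

(* In the last clause the sum is over finitely many directed edges, because
   each edge of the cut has exactly one direction from X to its complement. *)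
Definition nonelusive_flow (H : finZmodType) (G : multigraph)
    (f : dedge G -> H) : Prop :=
  [/\ forall d : dedge G, f d != 0,
      forall d d' : dedge G,
        dedge_edge d = dedge_edge d' ->
        source d = target d' -> target d = source d' ->
        source d <> target d -> f d = - f d'
    & forall X : set (vertex G), finite_set (cut X) ->
        \sum_(d \in [set d : dedge G | X (source d) /\ (~` X) (target d)]) f d
        = 0].

Definition has_nonelusive_flow (H : finZmodType) (G : multigraph) : Prop :=
  exists f : dedge G -> H, nonelusive_flow f.

Definition color_class (k : nat) (G : multigraph) (c : edge G -> 'I_k)
    (X : set (vertex G)) (i : 'I_k) : set (edge G) :=
  [set e | cut X e /\ c e = i].

Definition semi_edge_coloring (k : nat) (G : multigraph)
    (c : edge G -> 'I_k) : Prop :=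
  forall X : set (vertex G), finite_set (cut X) ->
  forall i j : 'I_k,
    odd #|` fset_set (color_class c X i)|%fset
    = odd #|` fset_set (color_class c X j)|%fset.

Definition semi_edge_colorable (k : nat) (G : multigraph) : Prop :=
  exists c : edge G -> 'I_k, semi_edge_coloring c.

(* Main.v *)
Require Import Defs.
From mathcomp Require Import filter ring.

(** Both properties are equivalent to the existence of two edge sets [A] and [B]
    that together contain every edge and each meet every finite cut in an even
    number of edges.

    For colorings ([semi_3_edge_colorableP]) this is the identification of the
    three colors with the nonzero elements of (Z/2)^2: let [A] and [B] be
    the complements of two color classes.  The three counts in a cut have the
    same parity exactly when every two of them have an even sum.

    For flows ([Z4_flowP]) the link is [even_signing]: if [A] meets
    every finite cut evenly, then [A] carries a flow with values 1 and -1,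
    vanishing off [A].  Given that flow [g], the function [g - 2 * 1_B] is a
    nowhere zero Z/4-flow, since 2 * 1_B is a flow when [B] is even.
    Conversely, the odd values of a Z/4-flow [phi] form an even set [A]
    (double the flow), and subtracting the corresponding [g] leaves a flow with
    values 0 and 2, whose support is even.  Adding the edges with value 2 to
    [A] already exhausts all edges, and they lie in that support.

    In a finite graph [even_signing] is the existence of Eulerian orientations
    ([signed_difference_sum0]).  For finitely many finite cuts, contract to a
    point every set of vertices that lie on the same side of each of these cuts:
    finitely many edges survive, and every cut of the contracted graph is a
    finite cut of the original one ([even_signing_seq]).  All finite cuts are
    then treated together by compactness, because each of them constrains
    finitely many signs ([bool_compactness]). *)

Set Implicit Arguments.
Unset Strict Implicit.
Unset Printing Implicit Defensive.
Import GRing.Theory.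
Local Open Scope classical_set_scope.
Local Open Scope ring_scope.

(** * Eulerian orientations of finite graphs *)

(** The edges [e] in [L] join [s e] to [t e]; [o e] says whether [e] is
    reversed.  The hypothesis is that all cuts are even, so the graph is
    Eulerian.  With [chi] the indicator of a vertex set, the sum is the net flow
    across a cut, which vanishes for an Eulerian orientation; allowing any [chi]
    makes the induction a telescoping identity.

    The induction splits off a path with two edges: a non-loop [e1] from [x] to
    [y] has a further edge [e2] at [y], as the degree of [y] is even.  Replacing
    both by a single edge from [x] to the other end of [e2] preserves all cut
    parities, and an orientation of the new edge lifts to the path. *)
Lemma signed_difference_sum0 (V E : eqType) (s t : E -> V) (L : seq E) :
    uniq L ->
    (forall p : pred V, ~~ odd (count (fun e => p (s e) (+) p (t e)) L)) ->
  exists o : E -> bool, forall chi : V -> int,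
    \sum_(e <- L) (-1) ^+ (o e) * (chi (s e) - chi (t e)) = 0.
Proof.
elim: {L}(size L) {-2}L (leqnn (size L)) s t => [|n IHn] [|e1 L] //= szL s t;
  try by move=> _ _; exists (fun=> false) => chi; rewrite big_nil.
move=> /andP[e1L uL] evenL.
have [loop1|nloop1] := eqVneq (s e1) (t e1).
  have [|o oP] := IHn L szL s t uL.
    by move=> p; have := evenL p; rewrite loop1 addbb.
  by exists o => chi; rewrite big_cons loop1 subrr mulr0 add0r oP.
have /hasP[e2 e2L e2P] : has (fun e => (s e == t e1) (+) (t e == t e1)) L.
  rewrite has_count; have := evenL (pred1 (t e1)).
  by rewrite /= eqxx (negPf nloop1) oddD; case: (count _ L).
have szL' : (size L <= n)%N by [].
have neq12 : e2 != e1 by apply: contraNneq e1L => <-.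
(* [e2] stands for the new edge in the smaller graph; [b] tells that [e2] points
   towards the middle vertex of the path. *)
pose b := t e2 == t e1.
pose s' e := if e == e2 then s e1 else s e.
pose t' e := if e == e2 then (if b then s e2 else t e2) else t e.
have sE : (if b then t e2 else s e2) = t e1.
  move: e2P; rewrite /b; case: (eqVneq (t e2)) => // _.
  by rewrite addbF => /eqP.
have [|o oP] := IHn L szL' s' t' uL.
  move=> p; have := evenL p; rewrite !(permP (perm_to_rem e2L)) /=.
  rewrite /s' /t' !eqxx !oddD.
  have -> : count (fun e => p (if e == e2 then s e1 else s e) (+)
       p (if e == e2 then if b then s e2 else t e2 else t e)) (rem e2 L)
     = count (fun e => p (s e) (+) p (t e)) (rem e2 L).
    apply: eq_in_count => e.
    by rewrite (mem_rem_uniq e2 uL) inE => /andP[/negPf->].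
  rewrite -sE; case: (b); move: (odd _) (p _) (p _) (p _);
  by do 4![case].
exists (fun e =>
  if e == e1 then o e2 else if e == e2 then b (+) o e2 else o e).
move=> chi; have := oP chi.
rewrite big_cons !(big_rem e2 e2L) /= !eqxx (negPf neq12) /s' /t' eqxx => oE.
rewrite addrA -[RHS]oE; congr (_ + _).
  by rewrite -sE signr_addb; case: (b) => /=; ring.
rewrite big_seq [RHS]big_seq; apply: eq_bigr => e.
rewrite (mem_rem_uniq e2 uL) inE => /andP[/negPf-> eL].
by rewrite (negPf (memPn e1L e eL)).
Qed.

(** * Compactness *)

(** Choose a solution for each finite list of constraints, and take the limit of
    these along an ultrafilter that contains, for each [l], all lists extending
    [l].  On the finite set [D i] the limit agrees with the chosen
    solution for almost every list, hence for some list containing [i]. *)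
Lemma bool_compactness (E : choiceType) (I : eqType) (D : I -> {fset E})
    (P : I -> (E -> bool) -> Prop) :
    (forall i o o', {in D i, o =1 o'} -> P i o -> P i o') ->
    (forall l : seq I, exists o, forall i, i \in l -> P i o) ->
  exists o, forall i, P i o.
Proof.
move=> Ploc /choice[sol solP].
pose F := filter_from setT
  (fun l : seq I => [set l' : seq I | {subset l <= l'}]).
have FF : ProperFilter F.
  apply: filter_from_proper => [|l _]; last by exists l.
  apply: filter_from_filter; first by exists [::].
  move=> l l' _ _; exists (l ++ l') => // m lm; split=> e el; apply: lm => /=;
  by rewrite mem_cat el ?orbT.
have [U [UU FU]] := ultraFilterLemma FF.
pose o e := `[< U [set l | sol l e] >].
exists o => i.
have Ui : U [set l : seq I | i \in l].
  by apply: FU; exists [:: i] => // l; apply; rewrite mem_head.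
have UD : U (\bigcap_(e in [set` D i]) [set l | sol l e = o e]).
  apply: filter_bigI => e _; rewrite /o; case: asboolP => [|nU].
    by apply: filterS => l /= ->.
  have [//|] := in_ultra_setVsetC [set l | sol l e] UU.
  by apply: filterS => l /= /negP/negPf.
have [l [il lD]] := filter_ex (filterI Ui UD).
by apply: (Ploc _ (sol l)) (solP l _ il) => e eD; apply: lD.
Qed.

(** * Cuts and flows relative to a reference orientation *)

Section ReferenceOrientation.
Variable G : multigraph.
Implicit Types (e : edge G) (X : set (vertex G)) (A B : pred (edge G)).

Definition tail e : vertex G := projT1 (cid (joinsP e)).
Definition head e : vertex G := projT1 (cid (projT2 (cid (joinsP e)))).

Lemma joins_ends e u v : joins e u v <->
  (u = tail e /\ v = head e) \/ (u = head e /\ v = tail e).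
Proof. by rewrite /head /tail; case: cid => x /= ex; case: cid => y /= ->. Qed.

Lemma joins_tail_head e : joins e (tail e) (head e).
Proof. by apply/joins_ends; left. Qed.

(** On the edges of a cut this is the sign comparing the reference orientation
    with the direction from [X] to its complement; elsewhere it is 0. *)
Definition coboundary X e : int := (tail e \in X)%:R - (head e \in X)%:R.

Lemma mem_cut X e : (e \in cut X) = (tail e \in X) (+) (head e \in X).
Proof.
apply/idP/idP => [|].
  rewrite inE => -[x [y [/joins_ends exy Xx Xy]]].
  by case: exy Xx Xy => -[-> ->] Xx Xy;
    rewrite (mem_set Xx) (memNset Xy).
case: (boolP (tail e \in X)); case: (boolP (head e \in X)) => //;
  rewrite ?notin_setE ?inE => h1 h2 _.
- by exists (tail e), (head e); split => //; apply: joins_tail_head.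
- by exists (head e), (tail e); split => //; apply/joins_ends; right.
Qed.

Lemma mem_fset_cut X e : finite_set (cut X) ->
  (e \in fset_set (cut X)) = (tail e \in X) (+) (head e \in X).
Proof. by move=> finX; rewrite in_fset_set// mem_cut. Qed.

Definition balanced_on_cut (H : zmodType) (phi : edge G -> H) X : Prop :=
  finite_set (cut X) ->
    \sum_(e <- fset_set (cut X)) phi e *~ coboundary X e = 0.

Definition conservative (H : zmodType) (phi : edge G -> H) : Prop :=
  forall X, balanced_on_cut phi X.

Definition even_on_cuts A : Prop :=
  forall X, finite_set (cut X) -> ~~ odd (count A (fset_set (cut X))).

Lemma coboundary_cut X e : finite_set (cut X) -> e \in fset_set (cut X) ->
  coboundary X e = if tail e \in X then 1 else -1.
Proof.
move=> finX; rewrite mem_fset_cut// /coboundary.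
by case: (_ \in X); case: (_ \in X).
Qed.

Lemma conservativeB (H : zmodType) (phi psi : edge G -> H) :
  conservative phi -> conservative psi -> conservative (fun e => phi e - psi e).
Proof.
move=> cphi cpsi X finX; under eq_bigr do rewrite mulrzBl.
by rewrite sumrB cphi// cpsi// subrr.
Qed.

Lemma conservative_raddf (H K : zmodType) (h : {additive H -> K})
    (phi : edge G -> H) :
  conservative phi -> conservative (h \o phi).
Proof.
move=> cphi X finX; under eq_bigr do rewrite /= -raddfMz.
by rewrite -raddf_sum cphi// raddf0.
Qed.

Definition forward e : dedge G :=
  SigSub (mem_set (joins_tail_head e : @directed_edges G (e, tail e, head e))).

Lemma joins_dedge (d : dedge G) : joins (dedge_edge d) (source d) (target d).
Proof. exact: set_mem (valP d). Qed.

Definition outgoing X : set (dedge G) :=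
  [set d | X (source d) /\ (~` X) (target d)].

Lemma outgoing_bij X : set_bij (outgoing X) (cut X) (@dedge_edge G).
Proof.
split.
- by move=> d [Xs Xt]; exists (source d), (target d); have := joins_dedge d.
- move=> d d' /set_mem[Xs Xt] /set_mem[Xs' Xt'] dd'.
  apply: val_inj.
  rewrite [val d]surjective_pairing [(val d).1]surjective_pairing.
  rewrite [val d']surjective_pairing [(val d').1]surjective_pairing.
  move: (joins_dedge d) (joins_dedge d') dd' Xs Xt Xs' Xt'.
  rewrite /dedge_edge /source /target /= => dj + de; rewrite -de => dj'.
  move: dj dj' => /joins_ends + /joins_ends.
  by move=> [[-> ->]|[-> ->]] [[-> ->]|[-> ->]].
- move=> e [x [y [exy Xx Xy]]].
  by exists (SigSub (mem_set (exy : @directed_edges G (e, x, y)))).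
Qed.

Definition antisymmetric_on_dedges (H : zmodType) (f : dedge G -> H) : Prop :=
  forall d d' : dedge G,
    dedge_edge d = dedge_edge d' ->
    source d = target d' -> target d = source d' ->
    source d <> target d -> f d = - f d'.

Lemma sum_outgoing (H : zmodType) (f : dedge G -> H) X :
  finite_set (cut X) -> antisymmetric_on_dedges f ->
  \sum_(d \in outgoing X) f d
  = \sum_(e <- fset_set (cut X)) f (forward e) *~ coboundary X e.
Proof.
move=> finX fN.
rewrite -fsbig_finite// (reindex_fsbig _ _ _ _ (outgoing_bij X)).
apply: eq_fsbigr => d /set_mem[Xs Xt].
have eX : dedge_edge d \in fset_set (cut X).
  rewrite in_fset_set// mem_set//.
  by exists (source d), (target d); have := joins_dedge d.
rewrite coboundary_cut//; have /joins_ends := joins_dedge d.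
case=> -[sd td].
  rewrite -sd (mem_set Xs) mulr1z; congr f; apply: val_inj.
  case: d {Xs Xt eX} sd td => -[[e x] y] /= p.
  by rewrite /dedge_edge /source /target /= => -> ->.
rewrite -td (memNset Xt) mulrNz mulr1z; apply: fN => //.
by move=> st; apply: Xt; rewrite -st.
Qed.

(** A flow is determined by its values in the reference direction.  Loops cause
    no ambiguity: each has only one directed edge, and that is [forward]. *)
Lemma has_nonelusive_flowP (H : finZmodType) :
  has_nonelusive_flow H G <->
  exists2 phi : edge G -> H, forall e, phi e != 0 & conservative phi.
Proof.
split=> [[f [f0 fN f_cut]]|[phi phi0 cphi]].
  exists (f \o forward) => [e|X finX]; first exact: f0.
  by rewrite -sum_outgoing// f_cut.
pose f d := if source d == tail (dedge_edge d) then phi (dedge_edge d)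
            else - phi (dedge_edge d).
have fN : antisymmetric_on_dedges f.
  move=> d d' dd' st ts ns; rewrite /f -dd' -ts.
  have /joins_ends[] := joins_dedge d => -[sd td].
    by rewrite -sd eqxx eq_sym (introF eqP ns) opprK.
  by rewrite -td eqxx (introF eqP ns).
exists f; split => //.
  by move=> d; rewrite /f; case: ifP; rewrite ?oppr_eq0 phi0.
move=> X finX; rewrite sum_outgoing// -[RHS](cphi X finX).
by apply: eq_bigr => e _; rewrite /f /= eqxx.
Qed.

(** * Signing an even set of edges *)

Definition signed_indicator A (o : edge G -> bool) e : int :=
  if A e then (-1) ^+ o e else 0.

(** The map [q] contracts the graph: it sends a vertex to the list of the sides
    on which it lies. *)
Lemma even_signing_seq A (Xs : seq (set (vertex G))) : even_on_cuts A ->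
  exists o : edge G -> bool, forall X, X \in Xs ->
    balanced_on_cut (signed_indicator A o) X.
Proof.
move=> evenA.
pose fXs := [seq X <- Xs | `[< finite_set (cut X) >]].
have fXsP X : X \in fXs -> finite_set (cut X).
  by rewrite mem_filter => /andP[/asboolP].
pose C := \big[fsetU/fset0]_(X <- fXs) fset_set (cut X).
have memC e : (e \in C) = has (fun X => (tail e \in X) (+) (head e \in X)) fXs.
  rewrite /C; elim: (fXs) fXsP => [|X l IHl] lP; first by rewrite big_nil inE.
  rewrite big_cons inE mem_fset_cut /=; last by apply: lP; rewrite mem_head.
  by rewrite IHl// => Y Yl; apply: lP; rewrite in_cons Yl orbT.
(* [C] is the set of edges that [q] does not turn into loops. *)
pose q v := [seq v \in X | X <- fXs].
have qE e : e \notin C -> q (tail e) = q (head e).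
  rewrite memC => /hasPn eP; apply/eq_in_map => X /eP.
  by case: (_ \in X); case: (_ \in X).
have [||o oP] := @signed_difference_sum0 _ _ (q \o tail) (q \o head)
  [seq e <- C | A e].
- by rewrite filter_uniq// fset_uniq.
- move=> p; pose Y := [set v | p (q v)].
  have memY v : (v \in Y) = p (q v) by apply/idP/idP; rewrite inE.
  have subY : cut Y `<=` [set` C].
    move=> e /mem_set; rewrite mem_cut !memY; apply: contraLR => eC.
    by rewrite qE// addbb.
  have finY : finite_set (cut Y) := sub_finite_set subY (finite_fset C).
  have := evenA Y finY; rewrite count_filter -!size_filter.
  suff /perm_size-> : perm_eq [seq e <- fset_set (cut Y) | A e]
    (seq.filter (predI (fun e => p (q (tail e)) (+) p (q (head e))) A) C) by [].
  apply: uniq_perm; rewrite ?filter_uniq ?fset_uniq// => e.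
  rewrite !mem_filter mem_fset_cut// !memY.
  case: (boolP (e \in C)) => [_|/qE ->]; last by rewrite addbb !andbF.
  by rewrite /= andbT andbC.
exists o => X XXs finX.
have XfXs : X \in fXs by rewrite mem_filter XXs andbT; apply/asboolP.
pose chi (w : seq bool) : int := (nth false w (index X fXs))%:R.
have chiE v : chi (q v) = (v \in X)%:R.
  by rewrite /chi (nth_map set0) ?index_mem// nth_index.
have := oP chi; rewrite big_filter.
under eq_bigr do rewrite /= !chiE.
rewrite (bigID (fun e => e \in fset_set (cut X))) /=.
rewrite [X in _ + X]big1 ?addr0; last first.
  move=> e /andP[_]; rewrite mem_fset_cut//.
  by case: (_ \in X); case: (_ \in X); rewrite // subrr mulr0.
move=> S0; rewrite -[RHS]S0.
rewrite (eq_bigr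
    (fun e => if A e then (-1) ^+ o e * coboundary X e else 0)); last first.
  move=> e _; rewrite /signed_indicator.
  by case: (A e); rewrite ?mul0rz ?mulrzz.
rewrite -big_mkcond -big_filter -[RHS]big_filter /=; apply: perm_big.
apply: uniq_perm; rewrite ?filter_uniq ?fset_uniq// => e.
rewrite !mem_filter; case: (A e) => //=.
case: (boolP (e \in fset_set _)) => //=; rewrite mem_fset_cut// memC => eX.
by apply/esym/hasP; exists X.
Qed.

Lemma even_signing A : even_on_cuts A ->
  exists o : edge G -> bool, conservative (signed_indicator A o).
Proof.
move=> evenA.
apply: (@bool_compactness _ _ (fun X => fset_set (cut X))
  (fun X o => balanced_on_cut (signed_indicator A o) X)); last first.
  by move=> Xs; apply: even_signing_seq.
move=> X o o' oo' PX finX; rewrite -[RHS](PX finX) big_seq [RHS]big_seq.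
by apply: eq_bigr => e eX; rewrite /signed_indicator oo'.
Qed.

(** * Flows with values in Z/4 *)

(** Signs disappear because 2 = -2 in Z/4. *)
Lemma conservative_double B :
  conservative (fun e => 2 *+ B e : 'Z_4) <-> even_on_cuts B.
Proof.
have sumE X : finite_set (cut X) ->
    \sum_(e <- fset_set (cut X)) (2 *+ B e : 'Z_4) *~ coboundary X e
    = 2 *+ odd (count B (fset_set (cut X))).
  move=> finX; rewrite big_seq.
  rewrite (eq_bigr (fun e => 2 *+ B e)) => [|e eX]; last first.
    rewrite coboundary_cut//; case: ifP; rewrite ?mulrN1z ?mulr1z//.
    by case: (B e) => // _; apply: val_inj.
  rewrite -big_seq; elim: (enum_fset _) => [|e l IHl]; first by rewrite big_nil.
  by rewrite big_cons IHl /= oddD; case: (B e); case: (odd _); apply: val_inj.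
split=> cB X finX; last by rewrite sumE// (negPf (cB X finX)).
by apply/negP => oddX; have := sumE X finX; rewrite cB// oddX.
Qed.

(** Doubling the flow gives 2 on the edges of odd value and 0 elsewhere. *)
Lemma even_on_cuts_odd (phi : edge G -> 'Z_4) :
  conservative phi -> even_on_cuts (fun e => odd (phi e)).
Proof.
move=> cphi; apply/conservative_double.
have -> : (fun e => 2 *+ odd (phi e) : 'Z_4) = fun e => phi e *+ 2.
  by apply: funext => e; case: (phi e) => -[|[|[|[|//]]]] i; apply: val_inj.
move=> X finX; under eq_bigr do rewrite mulr2n mulrzDl.
by rewrite big_split /= cphi// addr0.
Qed.

Lemma Z4_flowP : has_nonelusive_flow 'Z_4 G <->
  exists A B, [/\ even_on_cuts A, even_on_cuts B & forall e, A e || B e].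
Proof.
pose g A (o : edge G -> bool) e : 'Z_4 := if A e then (-1) ^+ o e else 0.
have signing A : even_on_cuts A -> exists o, conservative (g A o).
  move=> /even_signing[o].
  move=> /(conservative_raddf (intmul 1 : {additive int -> 'Z_4})).
  rewrite (_ : _ \o _ = g A o); first by exists o.
  apply: funext => e; rewrite /g /= /signed_indicator.
  by case: (A e); case: (o e).
split=> [/has_nonelusive_flowP[phi phi0 cphi]|[A [B [evenA evenB AB]]]].
  pose A e := odd (phi e).
  have evenA : even_on_cuts A by exact: even_on_cuts_odd.
  have [o co] := signing A evenA.
  pose B e := phi e != g A o e.
  exists A, B; split=> //.
    apply/conservative_double.
    rewrite (_ : (fun e => 2 *+ B e) = fun e => phi e - g A o e).
      exact: conservativeB.
    apply: funext => e; rewrite /B /g /A.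
    by case: (phi e) => -[|[|[|[|//]]]] i; case: (o e); apply: val_inj.
  move=> e; rewrite /B /g /A.
  by case: (phi e) (phi0 e) => -[|[|[|[|//]]]] i.
have [o co] := signing A evenA.
have cB := (conservative_double B).2 evenB.
apply/has_nonelusive_flowP.
exists (fun e => g A o e - 2 *+ B e).
  by move=> e; rewrite /g; have := AB e; case: (A e); case: (B e); case: (o e).
exact: conservativeB.
Qed.

(** * Colorings *)

Lemma semi_edge_coloringP k (c : edge G -> 'I_k) :
  semi_edge_coloring c <->
  forall i j X, finite_set (cut X) ->
    odd (count (fun e => c e == i) (fset_set (cut X)))
    = odd (count (fun e => c e == j) (fset_set (cut X))).
Proof.
have cardE X i : finite_set (cut X) ->
    #|` fset_set (color_class c X i)|%fset
    = count (fun e => c e == i) (fset_set (cut X)).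
  move=> finX.
  have finXi : finite_set (color_class c X i).
    by apply: sub_finite_set finX => e [].
  rewrite -size_filter; apply: perm_size.
  apply: uniq_perm; rewrite ?filter_uniq ?fset_uniq// => e.
  rewrite mem_filter !in_fset_set//; apply/idP/andP.
    by rewrite inE => -[eX ->]; rewrite mem_set.
  by move=> [/eqP ei /set_mem eX]; rewrite mem_set.
split=> [cP i j X finX|cP X finX i j]; first by rewrite -!cardE//; apply: cP.
by rewrite !cardE//; apply: cP.
Qed.

Lemma semi_3_edge_colorableP : semi_edge_colorable 3 G <->
  exists A B, [/\ even_on_cuts A, even_on_cuts B & forall e, A e || B e].
Proof.
pose n (c : edge G -> 'I_3) i := count (fun e => c e == i).
have oddN c i j k l : uniq [:: i; j; k] ->
    odd (count (fun e => c e != i) l) = odd (n c j l) (+) odd (n c k l).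
  move=> ijk; elim: l => //= e l; rewrite /n !oddD => ->.
  rewrite addbACA; congr (_ (+) _); rewrite !oddb.
  move: ijk; case: i j k (c e) => -[|[|[|//]]] i [[|[|[|//]]] j];
  by case=> -[|[|[|//]]] k [[|[|[|//]]] m].
split=> [[c /semi_edge_coloringP cP]|[A [B [evenA evenB AB]]]].
  exists (fun e => c e != 0), (fun e => c e != 1); split.
  - by move=> X finX; rewrite (oddN c 0 1 (-1))// /n (cP 1 (-1) X finX) addbb.
  - by move=> X finX; rewrite (oddN c 1 0 (-1))// /n (cP 0 (-1) X finX) addbb.
  - by move=> e; case: (c e) => -[|[|[|//]]].
pose c e : 'I_3 := if ~~ A e then 0 else if ~~ B e then 1 else -1.
exists c; apply/semi_edge_coloringP => i j X finX.
have := evenA X finX; have := evenB X finX.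
rewrite -(@eq_count _ (fun e => c e != 1) B); last first.
  by move=> e; rewrite /c; have := AB e; case: (A e); case: (B e).
rewrite -(@eq_count _ (fun e => c e != 0) A); last first.
  by move=> e; rewrite /c; have := AB e; case: (A e); case: (B e).
rewrite (oddN c 0 1 (-1))// (oddN c 1 0 (-1))// !negb_add => /eqP n0 /eqP n1.
suff oddE k :
    odd (n c k (fset_set (cut X))) = odd (n c (-1) (fset_set (cut X))).
  by rewrite !oddE.
have [->|->|->] // : [\/ k = 0, k = 1 | k = -1].
by case: k => -[|[|[|//]]] k3; [constructor 1|constructor 2|constructor 3];
  apply: val_inj.
Qed.

End ReferenceOrientation.

Theorem theorem19 (G : multigraph) (G_connected : connected_graph G) :
  has_nonelusive_flow 'Z_4 G <-> semi_edge_colorable 3 G.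
Proof. exact: iff_trans (Z4_flowP G) (iff_sym (semi_3_edge_colorableP G)). Qed.
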